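(* Let $K=\langle a,b\mid b^{-1}ab=a^{-1}\rangle$ be the fundamental group of the Klein bottle. Then: (i) There exists a finitely generated group $G$ containing $K$ as a verbally closed subgroup such that $K$ is not a retract of $G$. (ii) For every finitely generated group $G$ containing $K$ as a verbally closed subgroup, there exists a subgroup $L\le G$ with $K\le L$ and $[G:L]\le 2$ such that $K$ is a retract of $L$.
   Context: A subgroup $H$ of a group $G$ is called verbally closed in $G$ if for every $n$, every element $w(x_1,\dots,x_n)$ of the free group $F(x_1,\dots,x_n)$ and every $h\in H$ the following holds: if there exist $g_1,\dots,g_n\in G$ with $w(g_1,\dots,g_n)=h$, then there exist $h_1,\dots,h_n\in H$ with $w(h_1,\dots,h_n)=h$. A subgroup $H$ of a group $L$ is a retract of $L$ if there is a homomorphism $\rho:L\to H$ with $\rho(h)=h$ for all $h\in H$ (equivalently, $H$ is the image of an endomorphism $\rho$ of $L$ with $\rho\circ\rho=\rho$). *)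

(* Defs.v *)
From Stdlib Require Import ZArith Lia.
Open Scope Z_scope.

Record Group := {
  carrier :> Type;
  gmul : carrier -> carrier -> carrier;
  gone : carrier;
  ginv : carrier -> carrier;
  gmulA : forall x y z, gmul x (gmul y z) = gmul (gmul x y) z;
  gmul1 : forall x, gmul gone x = x;
  gmulV : forall x, gmul (ginv x) x = gone
}.
Arguments gmul {g}. Arguments gone {g}. Arguments ginv {g}.

(** Group words: elements of a free group F(x_0, x_1, ...) represented by
    (not necessarily reduced) terms.  Variables are indexed by nat; a word
    only mentions finitely many of them, so this covers all F(x_1,...,x_n). *)
Inductive word : Type :=
| wvar : nat -> word
| wone : word
| wmul : word -> word -> word
| winv : word -> word.

Fixpoint weval {G : Group} (g : nat -> G) (w : word) : G :=
  match w with
  | wvar i => g i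
  | wone => gone
  | wmul u v => gmul (weval g u) (weval g v)
  | winv u => ginv (weval g u)
  end.

Definition is_subgroup {G : Group} (H : G -> Prop) : Prop :=
  H gone /\ (forall x y, H x -> H y -> H (gmul x y)) /\ (forall x, H x -> H (ginv x)).

Definition verbally_closed {G : Group} (H : G -> Prop) : Prop :=
  forall (w : word) (h : G), H h ->
    (exists g : nat -> G, weval g w = h) ->
    exists hs : nat -> G, (forall i, H (hs i)) /\ weval hs w = h.

Definition fin_generated (G : Group) : Prop :=
  exists (n : nat) (s : nat -> G),
    forall x : G, exists w : word,
      (forall i, (n <= i)%nat -> s i = gone) /\ weval s w = x.

Definition is_hom {G1 G2 : Group} (f : G1 -> G2) : Prop :=
  forall x y, f (gmul x y) = gmul (f x) (f y).

Definition image {A : Type} {G : Group} (f : A -> G) : G -> Prop :=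
  fun g => exists a, f a = g.

(** [H] (the image of the embedding [iota : K -> G]) is a retract of the
    subgroup [L] of [G]: there is a homomorphism [L -> K] which is the
    identity on [K] (identified with its image via [iota]). *)
Definition retract_of {K G : Group} (iota : K -> G) (L : G -> Prop) : Prop :=
  exists r : G -> K,
    (forall x y, L x -> L y -> r (gmul x y) = gmul (r x) (r y)) /\
    (forall k, r (iota k) = k).

(** Index of L in G at most 2: G is covered by the left cosets L and tL. *)
Definition index_le2 {G : Group} (L : G -> Prop) : Prop :=
  exists t : G, forall g : G, L g \/ L (gmul (ginv t) g).

(** The Klein bottle group K = < a, b | b^-1 a b = a^-1 >, realised as the
    semidirect product Z ⋊ Z: (m1,n1)(m2,n2) = (m1 + (-1)^n1 m2, n1 + n2),
    with a = (1,0), b = (0,1). *)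
Definition sgn (n : Z) : Z := if Z.even n then 1 else -1.

Lemma sgn_add n m : sgn (n + m) = sgn n * sgn m.
Proof. unfold sgn; rewrite Z.even_add; destruct (Z.even n), (Z.even m); reflexivity. Qed.

Lemma sgn_opp n : sgn (- n) = sgn n.
Proof. unfold sgn; rewrite Z.even_opp; reflexivity. Qed.

Lemma sgn_sq n : sgn n * sgn n = 1.
Proof. unfold sgn; destruct (Z.even n); reflexivity. Qed.

Definition kmul (x y : Z * Z) : Z * Z :=
  (fst x + sgn (snd x) * fst y, snd x + snd y).
Definition kinv (x : Z * Z) : Z * Z := (- (sgn (snd x) * fst x), - snd x).

Lemma kmulA x y z : kmul x (kmul y z) = kmul (kmul x y) z.
Proof.
  destruct x as [m1 n1], y as [m2 n2], z as [m3 n3]; unfold kmul; cbn [fst snd].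
  rewrite sgn_add. f_equal; ring.
Qed.

Lemma kmul1 x : kmul (0, 0) x = x.
Proof. destruct x as [m n]; unfold kmul; cbn [fst snd]. change (sgn 0) with 1. f_equal; ring. Qed.

Lemma kmulV x : kmul (kinv x) x = (0, 0).
Proof.
  destruct x as [m n]; unfold kmul, kinv; cbn [fst snd]. rewrite sgn_opp.
  f_equal; ring.
Qed.

Definition KleinGroup : Group :=
  {| carrier := Z * Z; gmul := kmul; gone := (0, 0); ginv := kinv;
     gmulA := kmulA; gmul1 := kmul1; gmulV := kmulV |}.

Definition ka : KleinGroup := (1, 0).
Definition kb : KleinGroup := (0, 1).

Lemma klein_relation : gmul (gmul (ginv kb) ka) kb = ginv ka.
Proof. reflexivity. Qed.

(* Main.v *)
(** Evaluate words in the generators [t] of [G] on tuples [k] of [K].  Once the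
    signs [chi] of the second coordinates of [k] are fixed, both coordinates of
    [w(k)] are linear in [k], with the Fox derivatives of [w] as coefficients.

    For (ii), solvability over [Z] of the linear system of all conditions
    [w(k) = h] (with [w(t) = h] in [K]) is obstructed by a single word.  If every
    sign pattern [chi] were obstructed, the obstructing words could be merged,
    one generator at a time, into one word violating verbal closedness.  For an
    unobstructed [chi], the solution gives a homomorphism [deg : G -> Z] and a
    [chi]-twisted cocycle [G -> Z]; they form a homomorphism to [K] on the
    subgroup where [chi = (-1)^deg].

    For (i), [chi = (-1)^deg] must fail on all of [G] for each [chi]: two
    involutions [c1], [c2] act on [Z^3] through the three nontrivial characters
    of [(Z/2)^2].  A single equation only sees one linear relation between the
    degrees of [c1] and [c2], and this is compatible with one of the three. *)
From Stdlib Require Import ZArith Lia Classical ClassicalEpsilon.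
Require Import Defs.
Open Scope Z_scope.

(** * Group identities, homomorphisms and word constructors *)

Section GroupFacts.
Context {G : Group}.
Implicit Types x y z : G.

Lemma gmul_cancel_l x y z : gmul x y = gmul x z -> y = z.
Proof.
  intros E. rewrite <- (gmul1 G y), <- (gmul1 G z), <- (gmulV G x), <- !gmulA.
  now rewrite E.
Qed.

Lemma gmulr1 x : gmul x gone = x.
Proof. apply (gmul_cancel_l (ginv x)). now rewrite gmulA, gmulV, gmul1. Qed.

Lemma gmulrV x : gmul x (ginv x) = gone.
Proof. apply (gmul_cancel_l (ginv x)). now rewrite gmulA, gmulV, gmul1, gmulr1. Qed.

Lemma ginv_unique x y : gmul x y = gone -> y = ginv x.
Proof. intros E. apply (gmul_cancel_l x). now rewrite E, gmulrV. Qed.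

Lemma weval_ext (g g' : nat -> G) w :
  (forall i, g i = g' i) -> weval g w = weval g' w.
Proof. intros E; induction w; cbn; congruence. Qed.

End GroupFacts.

Section HomFacts.
Context {G1 G2 : Group} (f : G1 -> G2) (hf : is_hom f).

Lemma hom_one : f gone = gone.
Proof. apply (gmul_cancel_l (f gone)). now rewrite <- hf, gmul1, gmulr1. Qed.

Lemma hom_inv x : f (ginv x) = ginv (f x).
Proof. apply ginv_unique. now rewrite <- hf, gmulrV, hom_one. Qed.

Lemma weval_hom g w : f (weval g w) = weval (fun i => f (g i)) w.
Proof.
  induction w; cbn; [reflexivity | apply hom_one | rewrite hf | rewrite hom_inv];
    congruence.
Qed.

End HomFacts.

Definition wconj (u v : word) : word := wmul (wmul u v) (winv u).
Definition wcomm (u v : word) : word := wmul (wmul u v) (winv (wmul v u)).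
Fixpoint wpow (u : word) (m : nat) : word :=
  match m with O => wone | S m => wmul u (wpow u m) end.

(** * Signs and the Klein bottle group *)

Lemma sgn_cases n : sgn n = 1 \/ sgn n = -1.
Proof. unfold sgn; destruct (Z.even n); auto. Qed.

Lemma pair_eq (A B : Type) (x y : A * B) : fst x = fst y -> snd x = snd y -> x = y.
Proof. destruct x, y; cbn; congruence. Qed.

Lemma kmul_fst (x y : Z * Z) : fst (kmul x y) = fst x + sgn (snd x) * fst y.
Proof. reflexivity. Qed.

Lemma kmul_snd (x y : Z * Z) : snd (kmul x y) = snd x + snd y.
Proof. reflexivity. Qed.

Lemma kinv_fst (x : Z * Z) : fst (kinv x) = - (sgn (snd x) * fst x).
Proof. reflexivity. Qed.

Lemma kinv_snd (x : Z * Z) : snd (kinv x) = - snd x.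
Proof. reflexivity. Qed.

Lemma sgn0 : sgn 0 = 1.
Proof. reflexivity. Qed.

Ltac ksimp :=
  cbn [weval gmul ginv gone KleinGroup];
  repeat rewrite ?kinv_fst, ?kinv_snd, ?kmul_fst, ?kmul_snd;
  rewrite ?sgn_add, ?sgn_opp;
  cbn [fst snd].

Lemma kcomm_snd (k : nat -> KleinGroup) u v : snd (weval k (wcomm u v)) = 0.
Proof. unfold wcomm. ksimp. lia. Qed.

(** Conjugation by an odd [v] negates the first coordinate of an even element and keeps its degree,
    so the commutator doubles the former and cancels the latter. *)
Lemma kcomm_even_odd (k : nat -> KleinGroup) u v :
  sgn (snd (weval k u)) = 1 -> sgn (snd (weval k v)) = -1 ->
  fst (weval k (wcomm u v)) = 2 * fst (weval k u).
Proof. intros Hu Hv. unfold wcomm. ksimp. rewrite Hu, Hv. lia. Qed.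

Lemma kconj_snd (k : nat -> KleinGroup) u v :
  snd (weval k (wconj u v)) = snd (weval k v).
Proof. unfold wconj. ksimp. lia. Qed.

Lemma kconj_fst (k : nat -> KleinGroup) u v :
  snd (weval k v) = 0 ->
  fst (weval k (wconj u v)) = sgn (snd (weval k u)) * fst (weval k v).
Proof.
  intros Hv. unfold wconj. ksimp. rewrite Hv, sgn0.
  destruct (sgn_cases (snd (weval k u))) as [-> | ->]; lia.
Qed.

Lemma kpow (k : nat -> KleinGroup) u m :
  snd (weval k u) = 0 ->
  weval k (wpow u m) = (Z.of_nat m * fst (weval k u), 0).
Proof.
  intros Hu. induction m as [|m IH]; [reflexivity|].
  cbn [wpow weval]. rewrite IH. apply pair_eq; ksimp; rewrite Hu, ?sgn0; lia.
Qed.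

(** * Integral linear systems *)

Fixpoint vec (n : nat) : Type :=
  match n with O => unit | S n => (Z * vec n)%type end.

Fixpoint vzero n : vec n :=
  match n with O => tt | S n => (0, vzero n) end.

Fixpoint vadd {n} : vec n -> vec n -> vec n :=
  match n with
  | O => fun _ _ => tt
  | S n => fun x y => (fst x + fst y, vadd (snd x) (snd y))
  end.

Fixpoint vscale {n} (z : Z) : vec n -> vec n :=
  match n with
  | O => fun _ => tt
  | S n => fun x => (z * fst x, vscale z (snd x))
  end.

(* [vbasis n i] is zero when [i >= n]. *)
Fixpoint vbasis n (i : nat) : vec n :=
  match n with
  | O => tt
  | S n => match i with O => (1, vzero n) | S i => (0, vbasis n i) end
  end.

Fixpoint dot {n} (m : nat -> Z) : vec n -> Z :=
  match n with
  | O => fun _ => 0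
  | S n => fun x => m O * fst x + dot (fun i => m (S i)) (snd x)
  end.

Lemma vscale0 n (x : vec n) : vscale 0 x = vzero n.
Proof. induction n; cbn [vadd vscale vzero dot vbasis fst snd]; [now destruct x|]. f_equal; auto. Qed.

Lemma vscaleDl n z z' (x : vec n) : vscale (z + z') x = vadd (vscale z x) (vscale z' x).
Proof. induction n; cbn [vadd vscale vzero dot vbasis fst snd]; [easy|]. f_equal; [lia | auto]. Qed.

Lemma vscaleA n z z' (x : vec n) : vscale z (vscale z' x) = vscale (z * z') x.
Proof. induction n; cbn [vadd vscale vzero dot vbasis fst snd]; [easy|]. f_equal; [lia | auto]. Qed.

Lemma vscale1 n (x : vec n) : vscale 1 x = x.
Proof. induction n; cbn [vadd vscale vzero dot vbasis fst snd]; [now destruct x|]. apply pair_eq; cbn [fst snd]; [lia | auto]. Qed.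

Lemma vscale_zero n z : vscale z (vzero n) = vzero n.
Proof. induction n; cbn [vadd vscale vzero dot vbasis fst snd]; [easy|]. f_equal; [lia | auto]. Qed.

Lemma vadd_zero n (x : vec n) : vadd x (vzero n) = x.
Proof. induction n; cbn [vadd vzero]; [now destruct x|]. apply pair_eq; cbn [fst snd]; [lia | auto]. Qed.

Lemma dot_add n m (x y : vec n) : dot m (vadd x y) = dot m x + dot m y.
Proof. revert m; induction n; intros m; cbn [vadd vscale vzero dot vbasis fst snd]; [easy|]. rewrite IHn. lia. Qed.

Lemma dot_scale n m z (x : vec n) : dot m (vscale z x) = z * dot m x.
Proof. revert m; induction n; intros m; cbn [vadd vscale vzero dot vbasis fst snd]; [lia|]. rewrite IHn. lia. Qed.

Lemma dot_zero n m : dot m (vzero n) = 0.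
Proof. revert m; induction n; intros m; cbn [vadd vscale vzero dot vbasis fst snd]; [easy|]. rewrite IHn. lia. Qed.

Lemma dot_basis n m i :
  (forall j, (n <= j)%nat -> m j = 0) -> dot m (vbasis n i) = m i.
Proof.
  revert m i; induction n as [|n IH]; intros m i Hm; cbn [vadd vscale vzero dot vbasis fst snd].
  - symmetry. apply Hm. lia.
  - destruct i as [|i]; cbn [vadd vscale vzero dot vbasis fst snd]; [rewrite dot_zero; lia|].
    rewrite IH; [lia|]. intros j Hj. apply Hm. lia.
Qed.

Lemma subgroup_scale n (M : vec n -> Z -> Prop) :
  M (vzero n) 0 ->
  (forall c c' h h', M c h -> M c' h' -> M (vadd c c') (h + h')) ->
  (forall c h, M c h -> M (vscale (-1) c) (- h)) ->
  forall z c h, M c h -> M (vscale z c) (z * h).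
Proof.
  intros M0 MD MN z c h Hc. induction z as [|z IH|z IH] using Z.peano_ind.
  - now rewrite vscale0.
  - replace (Z.succ z) with (1 + z) by lia. rewrite vscaleDl, vscale1.
    replace ((1 + z) * h) with (h + z * h) by lia. now apply MD.
  - replace (Z.pred z) with (-1 + z) by lia. rewrite vscaleDl.
    replace ((-1 + z) * h) with (- h + z * h) by lia. apply MD; auto.
Qed.

Definition linear_form {n} (f : vec n -> Z) : Prop :=
  (forall x y, f (vadd x y) = f x + f y) /\ (forall z x, f (vscale z x) = z * f x).

Definition linear_map {n p} (T : vec n -> vec p) : Prop :=
  (forall x y, T (vadd x y) = vadd (T x) (T y)) /\
  (forall z x, T (vscale z x) = vscale z (T x)).

(** The row [(-y/g, x/g)] completes the Bezout row to determinant 1; for [x = y = 0] the identity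
    matrix serves. *)
Lemma bezout_unimodular x y :
  exists a b c d g, a * x + b * y = g /\ c * x + d * y = 0 /\ a * d - b * c = 1.
Proof.
  destruct (Z.gcd_bezout x y _ eq_refl) as [a [b E]].
  destruct (Z.gcd_divide_l x y) as [x' Ex], (Z.gcd_divide_r x y) as [y' Ey].
  destruct (Z.eq_dec (Z.gcd x y) 0) as [H0|H0].
  - exists 1, 0, 0, 1, 0. rewrite H0 in *. lia.
  - exists a, b, (- y'), x', (Z.gcd x y). set (g := Z.gcd x y) in *. clearbody g.
    repeat split; [lia | rewrite Ex, Ey; ring |].
    apply Z.mul_cancel_r with g; [easy|].
    transitivity (a * x + b * y); [rewrite Ex, Ey; ring | lia].
Qed.

(** By induction the tail of [v] becomes [(y, 0, ..., 0)]; a Bezout matrix then merges [y] with the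
    head. [T'] applies the inverse matrix with rows [(d, -b)] and [(-c, a)]. *)
Lemma unimodular_reduction n (v : vec (S n)) :
  exists g (T T' : vec (S n) -> vec (S n)),
    linear_map T /\ linear_map T' /\ (forall x, T' (T x) = x) /\
    T v = (g, vzero n).
Proof.
  induction n as [|n IH].
  - exists (fst v), (fun x => x), (fun x => x). repeat split.
    now destruct v as [x []].
  - destruct v as [x w]. destruct (IH w) as [y [T [T' [[TD TZ] [[TD' TZ'] [TK Tw]]]]]].
    destruct (bezout_unimodular x y) as [a [b [c [d [g [E1 [E2 E3]]]]]]].
    exists g,
      (fun v => (a * fst v + b * fst (T (snd v)),
                 (c * fst v + d * fst (T (snd v)), snd (T (snd v))))),
      (fun v => (d * fst v - b * fst (snd v),
                 T' (- c * fst v + a * fst (snd v), snd (snd v)))).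
    split; [|split; [|split]].
    + split.
      * intros [x1 w1] [x2 w2]. change (vadd (n := S (S n)) (x1, w1) (x2, w2))
          with (x1 + x2, vadd w1 w2). cbn [fst snd]. rewrite TD.
        destruct (T w1), (T w2). cbn [vadd fst snd]. f_equal; [|f_equal]; ring.
      * intros z [x1 w1]. change (vscale (n := S (S n)) z (x1, w1))
          with (z * x1, vscale z w1). cbn [fst snd]. rewrite TZ.
        destruct (T w1). cbn [vscale fst snd]. f_equal; [|f_equal]; ring.
    + split.
      * intros [x1 [y1 u1]] [x2 [y2 u2]].
        apply pair_eq; [cbn; ring|]. refine (eq_trans _ (TD' _ _)).
        cbn [vadd fst snd]. f_equal. f_equal. ring.
      * intros z [x1 [y1 u1]].
        apply pair_eq; [cbn; ring|]. refine (eq_trans _ (TZ' _ _)).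
        cbn [vscale fst snd]. f_equal. f_equal. ring.
    + intros [x1 w1]. apply pair_eq; cbn [fst snd].
      * transitivity ((a * d - b * c) * x1); [ring | rewrite E3; ring].
      * transitivity (T' (T w1)); [f_equal | apply TK].
        destruct (T w1) as [y1 u1]. cbn [fst snd]. f_equal.
        transitivity ((a * d - b * c) * y1); [ring | rewrite E3; ring].
    + cbn [fst snd]. rewrite Tw. cbn [fst snd vzero]. apply pair_eq; cbn [fst snd]; [exact E1 | now rewrite E2].
Qed.

(* Divisibility of right-hand sides is the only obstruction to solving an
   integral system.  For [q = 0] the hypothesis says that [h] is determined by
   [c]. *)
Lemma integral_system_solvable n (M : vec n -> Z -> Prop) :
  (forall c c' h h', M c h -> M c' h' -> M (vadd c c') (h + h')) ->
  (forall z c h, M c h -> M (vscale z c) (z * h)) ->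
  (forall q u h, M (vscale q u) h -> (q | h)) ->
  exists f, linear_form f /\ forall c h, M c h -> f c = h.
Proof.
  revert M; induction n as [|n IH]; intros M MD MZ Mdiv.
  - exists (fun _ => 0). split; [split; lia|]. intros c h H.
    destruct (Mdiv 0 tt h) as [z ->]; [now destruct c | lia].
  - destruct (classic (exists v h, M v h /\ v <> vzero (S n)))
      as [[v [h [Mv nz_v]]] | H0].
    2:{ exists (fun _ => 0). split; [split; lia|]. intros c h H.
        destruct (classic (c = vzero (S n))) as [->|nz]; [|exfalso; eauto].
        (* Written as [0] times a vector, a zero coefficient vector has its right-hand side
           divisible by [0], hence zero. *)
        rewrite <- (vscale0 _ (vzero (S n))) in H.
        destruct (Mdiv _ _ _ H) as [z ->]. lia. }
    destruct (unimodular_reduction n v) as [g [T [T' [[TD TZ] [[TD' TZ'] [TK Tv]]]]]].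
    assert (Ev : v = vscale g (T' (1, vzero n))).
    { rewrite <- TZ'. cbn [vscale fst snd]. rewrite vscale_zero, Z.mul_1_r, <- Tv.
      now rewrite TK. }
    assert (nz_g : g <> 0).
    { intros ->. apply nz_v. rewrite Ev. apply vscale0. }
    (* [m1] is the value a solution must take at the primitive vector [T' (1, 0)], even if that
       vector does not occur in [M]. Substituting it leaves a system in [n] unknowns. *)
    destruct (Mdiv g (T' (1, vzero n)) h) as [m1 Eh]; [now rewrite <- Ev|].
    destruct (IH (fun u h' => exists x h0, M (T' (x, u)) h0 /\ h' = h0 - x * m1))
      as [f [[fD fZ] Hf]].
    + intros c c' h1 h2 [x [h0 [H ->]]] [x' [h0' [H' ->]]].
      exists (x + x'), (h0 + h0'). split; [|lia].
      assert (A := MD _ _ _ _ H H'). rewrite <- TD' in A. exact A.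
    + intros z c h1 [x [h0 [H ->]]]. exists (z * x), (z * h0). split; [|lia].
      assert (A := MZ z _ _ H). rewrite <- TZ' in A. exact A.
    + intros q u h1 [x [h0 [H ->]]].
      (* Subtracting [x] times the equation of [v] from [g] times the given one clears the first
         coordinate; the factor [g] cancels at the end. *)
      assert (A := MD _ _ _ _ (MZ g _ _ H) (MZ (- x) _ _ Mv)).
      assert (E : vadd (vscale g (T' (x, vscale q u))) (vscale (- x) v)
                  = vscale (g * q) (T' (0, u))).
      { rewrite Ev, vscaleA, <- !TZ', <- TD'. f_equal.
        cbn [vscale vadd fst snd]. rewrite vscale_zero, vadd_zero, vscaleA.
        f_equal; lia. }
      rewrite E in A. destruct (Mdiv _ _ _ A) as [z Ez]. exists z.
      apply Z.mul_cancel_l with g; [easy|]. lia.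
    + exists (fun c => fst (T c) * m1 + f (snd (T c))). split; [split|].
      * intros x y. rewrite TD. cbn [vadd fst snd]. rewrite fD. lia.
      * intros z x. rewrite TZ. cbn [vscale fst snd]. rewrite fZ. lia.
      * intros c h' Hc. rewrite (Hf _ (h' - fst (T c) * m1)); [lia|].
        exists (fst (T c)), h'. split; [|easy].
        rewrite <- surjective_pairing, TK. exact Hc.
Qed.

(** * Fox calculus for words evaluated in the Klein bottle group *)

Fixpoint wsgn (chi : nat -> Z) (w : word) : Z :=
  match w with
  | wvar i => chi i
  | wone => 1
  | wmul u v => wsgn chi u * wsgn chi v
  | winv u => wsgn chi u
  end.

(** Fox derivatives specialised along [chi]; the clause for [winv] uses that a sign is its own
    inverse. *)
Fixpoint fox n (chi : nat -> Z) (w : word) : vec n :=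
  match w with
  | wvar i => vbasis n i
  | wone => vzero n
  | wmul u v => vadd (fox n chi u) (vscale (wsgn chi u) (fox n chi v))
  | winv u => vscale (- wsgn chi u) (fox n chi u)
  end.

Lemma wsgn_cases chi w :
  (forall i, chi i = 1 \/ chi i = -1) -> wsgn chi w = 1 \/ wsgn chi w = -1.
Proof.
  intros Hchi. induction w; cbn; [apply Hchi | now left | | assumption].
  destruct IHw1 as [-> | ->], IHw2 as [-> | ->]; auto.
Qed.

Lemma wsgn_eval chi (k : nat -> KleinGroup) w :
  (forall i, sgn (snd (k i)) = chi i) -> sgn (snd (weval k w)) = wsgn chi w.
Proof. intros Hk. induction w; ksimp; cbn [wsgn]; [auto | easy | congruence | easy]. Qed.

Lemma fox_eval n chi (k : nat -> KleinGroup) w :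
  (forall i, (n <= i)%nat -> k i = gone) ->
  (forall i, sgn (snd (k i)) = chi i) ->
  fst (weval k w) = dot (fun i => fst (k i)) (fox n chi w).
Proof.
  intros Hn Hk. induction w; ksimp; cbn [fox].
  - rewrite dot_basis; [easy|]. intros j Hj. now rewrite Hn.
  - now rewrite dot_zero.
  - rewrite dot_add, dot_scale, (wsgn_eval chi) by easy. congruence.
  - rewrite dot_scale, (wsgn_eval chi), IHw by easy. lia.
Qed.

(** For this pattern [fox] gives exponent sums, which govern degrees in [K] whatever the actual
    signs are. *)
Definition triv : nat -> Z := fun _ => 1.

Lemma wsgn_triv w : wsgn triv w = 1.
Proof. induction w; cbn [wsgn]; rewrite ?IHw1, ?IHw2; easy. Qed.

Lemma fox_triv_eval n (k : nat -> KleinGroup) w :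
  (forall i, (n <= i)%nat -> k i = gone) ->
  snd (weval k w) = dot (fun i => snd (k i)) (fox n triv w).
Proof.
  intros Hn. induction w; ksimp; cbn [fox].
  - rewrite dot_basis; [easy|]. intros j Hj. now rewrite Hn.
  - now rewrite dot_zero.
  - rewrite dot_add, dot_scale, wsgn_triv. lia.
  - rewrite dot_scale, wsgn_triv. lia.
Qed.

Fixpoint wclip (n : nat) (w : word) : word :=
  match w with
  | wvar i => if (i <? n)%nat then wvar i else wone
  | wone => wone
  | wmul u v => wmul (wclip n u) (wclip n v)
  | winv u => winv (wclip n u)
  end.

Lemma weval_clip (G : Group) n (g : nat -> G) w :
  weval g (wclip n w) = weval (fun i => if (i <? n)%nat then g i else gone) w.
Proof.
  induction w; cbn [weval wclip]; [|congruence..]. now destruct (n0 <? n)%nat.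
Qed.

(** * Part (ii): a retraction on a subgroup of index at most two *)

Section VerballyClosed.

Context {G : Group} {iota : KleinGroup -> G}.
Hypotheses (hom_iota : is_hom iota) (inj_iota : forall x y, iota x = iota y -> x = y).
Hypothesis closed_iota : verbally_closed (image iota).
Context {n : nat} {t : nat -> G}.
Hypotheses (supp_t : forall i, (n <= i)%nat -> t i = gone)
  (gen_t : forall x, exists w, weval t w = x).

Definition evalsto (w : word) (h : KleinGroup) : Prop := weval t w = iota h.

Definition supported (k : nat -> KleinGroup) : Prop :=
  forall i, (n <= i)%nat -> k i = gone.

Lemma evalsto_one : evalsto wone gone.
Proof. symmetry. exact (hom_one iota hom_iota). Qed.

Lemma evalsto_mul u v x y :
  evalsto u x -> evalsto v y -> evalsto (wmul u v) (gmul x y).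
Proof. unfold evalsto; cbn [weval]; intros -> ->. now rewrite hom_iota. Qed.

Lemma evalsto_inv u x : evalsto u x -> evalsto (winv u) (ginv x).
Proof. unfold evalsto; cbn [weval]; intros ->. now rewrite (hom_inv iota). Qed.

Lemma evalsto_conj u v x y :
  evalsto u x -> evalsto v y -> evalsto (wconj u v) (gmul (gmul x y) (ginv x)).
Proof. intros Hu Hv. now repeat first [apply evalsto_mul | apply evalsto_inv]. Qed.

Lemma evalsto_comm u v x y :
  evalsto u x -> evalsto v y ->
  evalsto (wcomm u v) (gmul (gmul x y) (ginv (gmul y x))).
Proof. intros Hu Hv. now repeat first [apply evalsto_mul | apply evalsto_inv]. Qed.

Lemma evalsto_eq w x y : evalsto w x -> x = y -> evalsto w y.
Proof. now intros ? <-. Qed.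

Lemma evalsto_pow u z m :
  evalsto u (z, 0) -> evalsto (wpow u m) (Z.of_nat m * z, 0).
Proof.
  intros Hu. induction m as [|m IH]; [exact evalsto_one|].
  apply (evalsto_eq _ _ _ (evalsto_mul _ _ _ _ Hu IH)).
  apply pair_eq; ksimp; rewrite ?sgn0; lia.
Qed.

(** Verbal closedness enters the argument through this lemma. Clipping the word first lets the
    solution be trivial outside the first [n] variables. *)
Lemma solvable_in_klein w h :
  evalsto w h -> exists k, supported k /\ weval k w = h.
Proof.
  intros Hw. destruct (closed_iota (wclip n w) (iota h)) as [hs [Hhs E]].
  - now exists h.
  - exists t. rewrite weval_clip, <- Hw. apply weval_ext. intros i.
    destruct (Nat.ltb_spec i n); [easy | now rewrite supp_t].
  - pose (k := fun i => proj1_sig (constructive_indefinite_description _ (Hhs i))).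
    assert (Hk : forall i, iota (k i) = hs i).
    { intros i. exact (proj2_sig (constructive_indefinite_description _ (Hhs i))). }
    exists (fun i => if (i <? n)%nat then k i else gone). split.
    + intros i Hi. now destruct (Nat.ltb_spec i n); [lia|].
    + rewrite <- weval_clip. apply inj_iota. rewrite (weval_hom iota hom_iota), <- E.
      now apply weval_ext.
Qed.

(* A single word with value in [K] whose equation has no solution among the
   assignments satisfying [P]. *)
Definition separated (P : (nat -> KleinGroup) -> Prop) : Prop :=
  exists C N, 0 < N /\ evalsto C (N, 0) /\ (forall k : nat -> KleinGroup, snd (weval k C) = 0) /\
    forall k, P k -> fst (weval k C) <> N.

(** Inverting the word changes the sign of [N]; positivity lets [separated_merge] take natural
    powers. *)
Lemma separated_nonzero (P : (nat -> KleinGroup) -> Prop) C N :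
  N <> 0 -> evalsto C (N, 0) -> (forall k : nat -> KleinGroup, snd (weval k C) = 0) ->
  (forall k, P k -> fst (weval k C) <> N) -> separated P.
Proof.
  intros HN HC H0 HP. destruct (Z_lt_le_dec 0 N).
  - now exists C, N.
  - exists (winv C), (- N). split; [lia|]. split; [|split].
    + apply (evalsto_eq _ _ _ (evalsto_inv _ _ HC)).
      apply pair_eq; ksimp; rewrite ?sgn0; lia.
    + intros k. ksimp. rewrite H0. easy.
    + intros k Pk. ksimp. rewrite H0, sgn0. specialize (HP k Pk). lia.
Qed.

(* On [K], the word below is [C1 ^ 2] when the [i]-th variable has sign [1] and
   [C2 ^ 2] when it has sign [-1]; on [G], where [C1] and [C2] have the same
   value, the two conjugates cancel. *)
Lemma separated_merge (P : (nat -> KleinGroup) -> Prop) i :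
  separated (fun k => P k /\ sgn (snd (k i)) = 1) ->
  separated (fun k => P k /\ sgn (snd (k i)) = -1) ->
  separated P.
Proof.
  intros [D1 [N1 [pos1 [E1 [Z1 S1]]]]] [D2 [N2 [pos2 [E2 [Z2 S2]]]]].
  (* These powers give both words the same value at [t], namely [a] to the [N1 * N2], as the
     cancellation requires. *)
  pose (C1 := wpow D1 (Z.to_nat N2)). pose (C2 := wpow D2 (Z.to_nat N1)).
  assert (F1 : evalsto C1 (N1 * N2, 0)).
  { apply (evalsto_eq _ _ _ (evalsto_pow _ _ _ E1)). f_equal. lia. }
  assert (F2 : evalsto C2 (N1 * N2, 0)).
  { apply (evalsto_eq _ _ _ (evalsto_pow _ _ _ E2)). f_equal. lia. }
  assert (V1 : forall k : nat -> KleinGroup, weval k C1 = (N2 * fst (weval k D1), 0)).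
  { intros k. unfold C1. rewrite kpow, Z2Nat.id by (auto; lia). easy. }
  assert (V2 : forall k : nat -> KleinGroup, weval k C2 = (N1 * fst (weval k D2), 0)).
  { intros k. unfold C2. rewrite kpow, Z2Nat.id by (auto; lia). easy. }
  exists (wmul (wmul (wmul C1 (wconj (wvar i) C1)) (winv (wconj (wvar i) C2))) C2),
    (2 * (N1 * N2)).
  split; [lia|]. split; [|split].
  - unfold evalsto in *. unfold wconj. cbn [weval]. rewrite F1, F2.
    rewrite <- (gmulA _ (iota _) _ (ginv _)), gmulrV, gmulr1, <- hom_iota. f_equal.
    apply pair_eq; ksimp; rewrite ?sgn0; lia.
  - intros k. cbn [weval]. ksimp. rewrite !kconj_snd, V1, V2. easy.
  - intros k Pk. cbn [weval]. ksimp.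
    rewrite !kconj_snd, !kconj_fst by (rewrite ?V1, ?V2; easy).
    rewrite V1, V2. cbn [weval fst snd]. rewrite sgn0.
    destruct (sgn_cases (snd (k i))) as [Es | Es]; rewrite Es.
    + specialize (S1 k (conj Pk Es)). nia.
    + specialize (S2 k (conj Pk Es)). nia.
Qed.

Definition is_sign (chi : nat -> Z) : Prop := forall i, chi i = 1 \/ chi i = -1.

(* [f] is the first coordinate of a retraction whose sign character is [chi]. *)
Definition compatible (chi : nat -> Z) : Prop :=
  (forall w h, evalsto w h -> wsgn chi w = sgn (snd h)) /\
  exists f : vec n -> Z, linear_form f /\
    forall w h, evalsto w h -> wsgn chi w = 1 -> f (fox n chi w) = fst h.

(** Either some [wsgn chi w] differs from the sign of the value of [w], which conjugation by [w]
    exposes, or the linear system for [f] is unsolvable and [integral_system_solvable] supplies an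
    equation violating divisibility. *)
Lemma separated_incompatible chi :
  ~ compatible chi ->
  separated (fun k => supported k /\ forall i, sgn (snd (k i)) = chi i).
Proof.
  intros Hchi.
  destruct (gen_t (iota ka)) as [al Hal], (gen_t (iota kb)) as [be Hbe].
  destruct (classic (forall w h, evalsto w h -> wsgn chi w = sgn (snd h)))
    as [good | bad].
  - destruct (classic (forall w h q u, evalsto w h -> wsgn chi w = 1 ->
                         fox n chi w = vscale q u -> (q | fst h))) as [Hdiv | Hdiv].
    + exfalso. apply Hchi. split; [exact good|].
      pose (M := fun c z => exists w h, evalsto w h /\ wsgn chi w = 1 /\
                              c = fox n chi w /\ z = fst h).
      assert (MD : forall c c' z z', M c z -> M c' z' -> M (vadd c c') (z + z')).
      { intros c c' z z' [w [h [Ew [Sw [-> ->]]]]] [w' [h' [Ew' [Sw' [-> ->]]]]].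
        exists (wmul w w'), (gmul h h'). split; [now apply evalsto_mul|].
        cbn [wsgn fox]. rewrite Sw, Sw', vscale1. repeat split.
        ksimp. rewrite <- (good _ _ Ew), Sw. lia. }
      assert (MN : forall c z, M c z -> M (vscale (-1) c) (- z)).
      { intros c z [w [h [Ew [Sw [-> ->]]]]].
        exists (winv w), (ginv h). split; [now apply evalsto_inv|].
        cbn [wsgn fox]. rewrite Sw. repeat split.
        ksimp. rewrite <- (good _ _ Ew), Sw. lia. }
      destruct (integral_system_solvable n M) as [f [Lf Hf]].
      * exact MD.
      * apply subgroup_scale; [|exact MD | exact MN].
        exists wone, gone. repeat split. exact evalsto_one.
      * intros q u h [w [h' [Ew [Sw [Ec ->]]]]]. eauto.
      * exists f. split; [exact Lf|]. intros w h Ew Sw. apply Hf. now exists w, h.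
    + apply NNPP. intros Hsep. apply Hdiv. intros w h q u Ew Sw Eu.
      apply NNPP. intros Hq. apply Hsep.
      (* The commutator with [b] makes the degree vanish for every [k] and doubles both sides: [q]
         divides half of the value at [k], but not [fst h]. *)
      apply (separated_nonzero _ (wcomm w be) (2 * fst h)).
      * intros E. apply Hq. replace (fst h) with 0 by lia. apply Z.divide_0_r.
      * apply (evalsto_eq _ _ _ (evalsto_comm _ _ _ _ Ew Hbe)).
        assert (Sh := good _ _ Ew). rewrite Sw in Sh.
        apply pair_eq; ksimp; rewrite <- ?Sh; unfold kb; cbn [fst snd]; [|lia].
        change (sgn 1) with (-1). lia.
      * intros k. apply kcomm_snd.
      * intros k [Hs Hk]. rewrite kcomm_even_odd.
        -- rewrite (fox_eval n chi), Eu, dot_scale by auto. intros E. apply Hq.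
           exists (dot (fun i => fst (k i)) u). lia.
        -- now rewrite (wsgn_eval chi).
        -- rewrite (wsgn_eval chi) by auto. now rewrite (good _ _ Hbe).
  - apply NNPP. intros Hsep. apply bad. intros w h Ew.
    apply NNPP. intros Hs. apply Hsep.
    pose (X := wcomm al be).
    assert (EX : evalsto X (2, 0)) by exact (evalsto_comm _ _ _ _ Hal Hbe).
    assert (X0 : forall k : nat -> KleinGroup, snd (weval k X) = 0) by (intros; apply kcomm_snd).
    clearbody X.
    (* With the sign of [h] built into [Y], conjugation by [w] turns [Y] into [X] at [t], for a
       total of 4; under the wrong sign in [K] the two factors cancel to 0. *)
    pose (Y := if sgn (snd h) =? 1 then X else winv X).
    assert (EY : evalsto Y (2 * sgn (snd h), 0)).
    { unfold Y. destruct (sgn_cases (snd h)) as [-> | ->]; [exact EX|].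
      exact (evalsto_inv _ _ EX). }
    assert (Y0 : forall k : nat -> KleinGroup, snd (weval k Y) = 0).
    { intros k. unfold Y. destruct (sgn (snd h) =? 1); [auto|]. ksimp. now rewrite X0. }
    assert (Y1 : forall k : nat -> KleinGroup, fst (weval k Y) = sgn (snd h) * fst (weval k X)).
    { intros k. unfold Y. destruct (sgn_cases (snd h)) as [-> | ->]; cbn [Z.eqb Pos.eqb].
      - lia.
      - ksimp. rewrite X0, sgn0. lia. }
    clearbody Y.
    apply (separated_nonzero _ (wmul X (wconj w Y)) 4).
    + lia.
    + refine (evalsto_eq _ _ _ (evalsto_mul _ _ _ _ EX (evalsto_conj _ _ _ _ Ew EY)) _).
      apply pair_eq; ksimp; [|lia]. rewrite sgn0.
      destruct (sgn_cases (snd h)) as [-> | ->]; lia.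
    + intros k. cbn [weval]. ksimp. rewrite X0, kconj_snd, Y0. easy.
    + intros k [_ Hk]. cbn [weval]. ksimp. rewrite X0, kconj_fst, Y1, sgn0 by auto.
      rewrite (wsgn_eval chi k w) by auto.
      assert (Hc : wsgn chi w = 1 \/ wsgn chi w = -1).
      { apply wsgn_cases. intros i. rewrite <- Hk. apply sgn_cases. }
      destruct Hc as [Hc | Hc], (sgn_cases (snd h)) as [Hh | Hh];
        rewrite Hc, Hh in *; lia.
Qed.

Lemma compatible_exists : exists chi, is_sign chi /\ compatible chi.
Proof.
  apply NNPP. intros Hno.
  (* Descending induction on the number [j] of prescribed signs, from [n] down to [0]. *)
  assert (Hsep : forall d j, (j + d = n)%nat -> forall chi, is_sign chi ->
    separated (fun k => supported k /\ forall i, (i < j)%nat -> sgn (snd (k i)) = chi i)).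
  { induction d as [|d IH]; intros j Ej chi Hchi.
    (* Signs past [n] are set to 1, the sign of the identity, to match supported assignments. *)
    - destruct (separated_incompatible (fun i => if (i <? j)%nat then chi i else 1))
        as [C [N [pos [EC [C0 HC]]]]].
      + intros Hc. apply Hno. eexists. split; [|exact Hc].
        intros i. destruct (i <? j)%nat; auto.
      + exists C, N. repeat split; auto. intros k [Hs Hk]. apply HC. split; [easy|].
        intros i. destruct (Nat.ltb_spec i j); [auto|].
        rewrite Hs by lia. reflexivity.
    - assert (Hb : forall e, e = 1 \/ e = -1 ->
        separated (fun k => (supported k /\ forall i, (i < j)%nat -> sgn (snd (k i)) = chi i)
                            /\ sgn (snd (k j)) = e)).
      { intros e He.
        destruct (IH (S j) ltac:(lia) (fun i => if (i =? j)%nat then e else chi i))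
          as [C [N [pos [EC [C0 HC]]]]].
        - intros i. destruct (i =? j)%nat; auto.
        - exists C, N. repeat split; auto. intros k [[Hs Hk] Hj]. apply HC.
          split; [easy|]. intros i Hi. destruct (Nat.eqb_spec i j) as [-> | Hij]; [easy|].
          apply Hk. lia. }
      apply (separated_merge _ j); apply Hb; auto. }
  (* With no sign prescribed, the separating word has no supported solution in [K], against verbal
     closedness. *)
  destruct (Hsep n 0%nat ltac:(lia) triv) as [C [N [_ [EC [_ HC]]]]].
  - now left.
  - destruct (solvable_in_klein _ _ EC) as [k [Hs Hk]].
    apply (HC k); [split; [easy | lia]|]. now rewrite Hk.
Qed.

(** Degrees in [K] are linear in exponent sums for every sign pattern, so one solution in [K] of
    each equation already yields the divisibility. *)
Lemma degree_exists :
  exists f : vec n -> Z, linear_form f /\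
    forall w h, evalsto w h -> f (fox n triv w) = snd h.
Proof.
  pose (M := fun c z => exists w h, evalsto w h /\ c = fox n triv w /\ z = snd h).
  assert (MD : forall c c' z z', M c z -> M c' z' -> M (vadd c c') (z + z')).
  { intros c c' z z' [w [h [Ew [-> ->]]]] [w' [h' [Ew' [-> ->]]]].
    exists (wmul w w'), (gmul h h'). split; [now apply evalsto_mul|].
    cbn [fox]. rewrite wsgn_triv, vscale1. easy. }
  assert (MN : forall c z, M c z -> M (vscale (-1) c) (- z)).
  { intros c z [w [h [Ew [-> ->]]]].
    exists (winv w), (ginv h). split; [now apply evalsto_inv|].
    cbn [fox]. rewrite wsgn_triv. easy. }
  destruct (integral_system_solvable n M) as [f [Lf Hf]].
  - exact MD.
  - apply subgroup_scale; [|exact MD | exact MN].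
    exists wone, gone. repeat split. exact evalsto_one.
  - intros q u h [w [h' [Ew [Eu ->]]]].
    destruct (solvable_in_klein _ _ Ew) as [k [Hs Hk]].
    rewrite <- Hk, (fox_triv_eval n), <- Eu, dot_scale by easy.
    exists (dot (fun i => snd (k i)) u). lia.
  - exists f. split; [exact Lf|]. intros w h Ew. apply Hf. now exists w, h.
Qed.

Lemma retract_of_index2 :
  exists L : G -> Prop,
    is_subgroup L /\ (forall k, L (iota k)) /\ index_le2 L /\ retract_of iota L.
Proof.
  destruct compatible_exists as [chi [Hchi [good [f [[fD fZ] Hf]]]]].
  destruct degree_exists as [e [[eD eZ] He]].
  destruct (gen_t (iota kb)) as [be Hbe].
  assert (Hsgn := fun w => wsgn_cases chi w Hchi).
  pose (deg w := e (fox n triv w)).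
  assert (degM : forall u v, deg (wmul u v) = deg u + deg v).
  { intros u v. unfold deg. cbn [fox]. now rewrite eD, eZ, wsgn_triv, Z.mul_1_l. }
  assert (degV : forall u, deg (winv u) = - deg u).
  { intros u. unfold deg. cbn [fox]. rewrite eZ, wsgn_triv. lia. }
  (* Subtracting [f (fox be)] on words of sign [-1] is what sends [b] to [(0, 1)]. *)
  pose (fstc w := f (fox n chi w) - if wsgn chi w =? 1 then 0 else f (fox n chi be)).
  (* The subtracted term is a constant times [(1 - chi) / 2], itself a [chi]-twisted cocycle, so
     [fstc] remains one. *)
  assert (fstcM : forall u v, fstc (wmul u v) = fstc u + wsgn chi u * fstc v).
  { intros u v. unfold fstc. cbn [fox wsgn]. rewrite fD, fZ.
    destruct (Hsgn u) as [-> | ->], (Hsgn v) as [-> | ->];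
      change (1 * 1) with 1; change (1 * -1) with (-1); change (-1 * 1) with (-1);
      change (-1 * -1) with 1; cbn [Z.eqb Pos.eqb]; ring. }
  assert (fstcV : forall u, fstc (winv u) = - (wsgn chi u * fstc u)).
  { intros u. unfold fstc. cbn [fox wsgn]. rewrite fZ.
    destruct (Hsgn u) as [-> | ->]; cbn [Z.eqb Pos.eqb]; lia. }
  assert (fstcE : forall w h, evalsto w h -> fstc w = fst h).
  { intros w h Ew. destruct (Hsgn w) as [Sw | Sw].
    - unfold fstc. rewrite Sw, (Hf _ _ Ew Sw). cbn [Z.eqb Pos.eqb]. lia.
    (* Dividing by [be] gives a word of sign 1, to which the equation for [f] applies. *)
    - assert (Ev := evalsto_mul _ _ _ _ Ew (evalsto_inv _ _ Hbe)).
      assert (Sbe := good _ _ Hbe). change (wsgn chi be = -1) in Sbe.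
      assert (E := Hf _ _ Ev). cbn [wsgn fox] in E. rewrite Sw, Sbe in E.
      specialize (E eq_refl). rewrite fD, !fZ in E. unfold fstc. rewrite Sw.
      cbn [Z.eqb Pos.eqb]. revert E. ksimp. unfold kb; cbn [fst snd]. lia. }
  (* This character compares [chi] with the parity of the degree; [L] will be its kernel. *)
  pose (lam w := wsgn chi w * sgn (deg w)).
  assert (lam_cases : forall w, lam w = 1 \/ lam w = -1).
  { intros w. unfold lam.
    destruct (Hsgn w) as [-> | ->], (sgn_cases (deg w)) as [-> | ->]; auto. }
  assert (lamM : forall u v, lam (wmul u v) = lam u * lam v).
  { intros u v. unfold lam. cbn [wsgn]. rewrite degM, sgn_add. ring. }
  assert (lamV : forall u, lam (winv u) = lam u).
  { intros u. unfold lam. cbn [wsgn]. now rewrite degV, sgn_opp. }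
  (* If [u] and [v] agree in [G], then [u v^-1] evaluates to the identity of [K], where sign, degree
     and first coordinate are known. *)
  assert (wd : forall u v, weval t u = weval t v ->
                 fstc u = fstc v /\ deg u = deg v /\ lam u = lam v).
  { intros u v E.
    assert (Ew : evalsto (wmul u (winv v)) gone).
    { unfold evalsto. cbn [weval]. now rewrite E, gmulrV, (hom_one iota). }
    assert (S1 := good _ _ Ew). assert (E1 := fstcE _ _ Ew).
    assert (E2 := He _ _ Ew). fold (deg (wmul u (winv v))) in E2.
    rewrite degM, degV in E2. rewrite fstcM, fstcV in E1.
    cbn [wsgn] in S1. cbn [gone KleinGroup fst snd] in *. rewrite sgn0 in S1.
    assert (S : wsgn chi u = wsgn chi v).
    { destruct (Hsgn u) as [Su | Su], (Hsgn v) as [Sv | Sv]; rewrite Su, Sv in *; lia. }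
    assert (D : deg u = deg v) by lia.
    unfold lam. rewrite S, D. repeat split.
    rewrite S in E1. destruct (Hsgn v) as [Sv | Sv]; rewrite Sv in E1; lia. }
  pose (wof g := proj1_sig (constructive_indefinite_description _ (gen_t g))).
  assert (Hwof : forall g, weval t (wof g) = g).
  { intros g. exact (proj2_sig (constructive_indefinite_description _ (gen_t g))). }
  clearbody wof.
  assert (wofM : forall g g', fstc (wof (gmul g g')) = fstc (wmul (wof g) (wof g')) /\
                   deg (wof (gmul g g')) = deg (wmul (wof g) (wof g')) /\
                   lam (wof (gmul g g')) = lam (wmul (wof g) (wof g'))).
  { intros g g'. apply wd. cbn [weval]. now rewrite !Hwof. }
  assert (wofV : forall g, lam (wof (ginv g)) = lam (wof g)).
  { intros g. rewrite <- (lamV (wof g)). apply wd. cbn [weval]. now rewrite !Hwof. }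
  assert (wofE : forall h, evalsto (wof (iota h)) h) by (intros h; apply Hwof).
  assert (degE : forall h, deg (wof (iota h)) = snd h).
  { intros h. apply (He _ _ (wofE h)). }
  assert (lamE : forall h, lam (wof (iota h)) = 1).
  { intros h. unfold lam. rewrite degE, (good _ _ (wofE h)). apply sgn_sq. }
  exists (fun g => lam (wof g) = 1). split; [|split; [|split]].
  - split; [|split].
    + rewrite <- (hom_one iota hom_iota). apply lamE.
    + intros x y Hx Hy. destruct (wofM x y) as [_ [_ ->]]. rewrite lamM. lia.
    + intros x Hx. now rewrite wofV.
  - exact lamE.
  - destruct (classic (exists x, lam (wof x) = -1)) as [[x Hx] | Hno].
    + exists x. intros g. destruct (lam_cases (wof g)) as [Hg | Hg]; [now left | right].
      destruct (wofM (ginv x) g) as [_ [_ ->]]. rewrite lamM, wofV. lia.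
    + exists gone. intros g. left. destruct (lam_cases (wof g)); [easy|].
      exfalso; eauto.
  - exists (fun g => (fstc (wof g), deg (wof g))). split.
    + intros x y Hx Hy. destruct (wofM x y) as [-> [-> _]].
      (* On [L] the sign of [x] is that of its degree, so the twist of the cocycle is the one in
         [kmul]. *)
      rewrite fstcM, degM. apply pair_eq; ksimp; [|easy]. unfold lam in Hx.
      destruct (Hsgn (wof x)) as [Sx | Sx], (sgn_cases (deg (wof x))) as [Dx | Dx];
        rewrite Sx, Dx in *; lia.
    + intros h. apply pair_eq; cbn [fst snd]; [|apply degE]. apply fstcE, wofE.
Qed.

End VerballyClosed.

(** * A verbally closed non-retract *)

(* The extension of [Z^3] by [<b> x <c1> x <c2>], where [b] acts as [-1], and
   [c1], [c2] act as [diag(-1,1,-1)], [diag(1,-1,-1)]; in [wit] the [c_i] have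
   order two, in its cover [cov] they have infinite order. *)
Record wit := Wit { w1 : Z; w2 : Z; w3 : Z; wdeg : Z; wc1 : bool; wc2 : bool }.

Definition bsgn (e : bool) : Z := if e then -1 else 1.

Lemma bsgn_xor e e' : bsgn (xorb e e') = bsgn e * bsgn e'.
Proof. now destruct e, e'. Qed.

Definition wit_mul (x y : wit) : wit :=
  Wit (w1 x + sgn (wdeg x) * bsgn (wc1 x) * w1 y)
      (w2 x + sgn (wdeg x) * bsgn (wc2 x) * w2 y)
      (w3 x + sgn (wdeg x) * (bsgn (wc1 x) * bsgn (wc2 x)) * w3 y)
      (wdeg x + wdeg y) (xorb (wc1 x) (wc1 y)) (xorb (wc2 x) (wc2 y)).

Definition wit_inv (x : wit) : wit :=
  Wit (- (sgn (wdeg x) * bsgn (wc1 x) * w1 x))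
      (- (sgn (wdeg x) * bsgn (wc2 x) * w2 x))
      (- (sgn (wdeg x) * (bsgn (wc1 x) * bsgn (wc2 x)) * w3 x))
      (- wdeg x) (wc1 x) (wc2 x).

Lemma wit_mulA x y z : wit_mul x (wit_mul y z) = wit_mul (wit_mul x y) z.
Proof.
  unfold wit_mul; cbn. rewrite !bsgn_xor, !sgn_add, !Bool.xorb_assoc.
  f_equal; ring.
Qed.

Lemma wit_mul1 x : wit_mul (Wit 0 0 0 0 false false) x = x.
Proof. destruct x as [x1 x2 x3 d [] []]; unfold wit_mul; cbn [w1 w2 w3 wdeg wc1 wc2];
  rewrite sgn0; unfold bsgn; f_equal; lia. Qed.

Lemma wit_mulV x : wit_mul (wit_inv x) x = Wit 0 0 0 0 false false.
Proof.
  unfold wit_mul, wit_inv; cbn [w1 w2 w3 wdeg wc1 wc2].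
  rewrite sgn_opp, !Bool.xorb_nilpotent. f_equal; ring.
Qed.

Definition WitGroup : Group :=
  {| carrier := wit; gmul := wit_mul; gone := Wit 0 0 0 0 false false; ginv := wit_inv;
     gmulA := wit_mulA; gmul1 := wit_mul1; gmulV := wit_mulV |}.

Record cov := Cov { v1 : Z; v2 : Z; v3 : Z; vdeg : Z; vc1 : Z; vc2 : Z }.

Definition cov_mul (x y : cov) : cov :=
  Cov (v1 x + sgn (vdeg x) * sgn (vc1 x) * v1 y)
      (v2 x + sgn (vdeg x) * sgn (vc2 x) * v2 y)
      (v3 x + sgn (vdeg x) * (sgn (vc1 x) * sgn (vc2 x)) * v3 y)
      (vdeg x + vdeg y) (vc1 x + vc1 y) (vc2 x + vc2 y).

Definition cov_inv (x : cov) : cov :=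
  Cov (- (sgn (vdeg x) * sgn (vc1 x) * v1 x))
      (- (sgn (vdeg x) * sgn (vc2 x) * v2 x))
      (- (sgn (vdeg x) * (sgn (vc1 x) * sgn (vc2 x)) * v3 x))
      (- vdeg x) (- vc1 x) (- vc2 x).

Lemma cov_mulA x y z : cov_mul x (cov_mul y z) = cov_mul (cov_mul x y) z.
Proof. unfold cov_mul; cbn. rewrite !sgn_add. f_equal; ring. Qed.

Lemma cov_mul1 x : cov_mul (Cov 0 0 0 0 0 0) x = x.
Proof.
  destruct x; unfold cov_mul; cbn [v1 v2 v3 vdeg vc1 vc2]. rewrite sgn0. f_equal; ring.
Qed.

Lemma cov_mulV x : cov_mul (cov_inv x) x = Cov 0 0 0 0 0 0.
Proof.
  unfold cov_mul, cov_inv; cbn [v1 v2 v3 vdeg vc1 vc2]. rewrite !sgn_opp. f_equal; ring.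
Qed.

Definition CovGroup : Group :=
  {| carrier := cov; gmul := cov_mul; gone := Cov 0 0 0 0 0 0; ginv := cov_inv;
     gmulA := cov_mulA; gmul1 := cov_mul1; gmulV := cov_mulV |}.

Definition cov_proj (x : CovGroup) : WitGroup :=
  Wit (v1 x) (v2 x) (v3 x) (vdeg x) (Z.odd (vc1 x)) (Z.odd (vc2 x)).

Definition cov_lift (x : WitGroup) : CovGroup :=
  Cov (w1 x) (w2 x) (w3 x) (wdeg x) (Z.b2z (wc1 x)) (Z.b2z (wc2 x)).

Lemma bsgn_odd n : bsgn (Z.odd n) = sgn n.
Proof. unfold sgn, bsgn. rewrite <- Z.negb_even. now destruct (Z.even n). Qed.

Lemma cov_proj_hom : is_hom cov_proj.
Proof.
  intros x y. unfold cov_proj. cbn. unfold wit_mul. cbn.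
  now rewrite !bsgn_odd, !Z.odd_add.
Qed.

Lemma cov_liftK x : cov_proj (cov_lift x) = x.
Proof. now destruct x as [x1 x2 x3 d [] []]. Qed.

(* The component of [Z^3] on which [c1], [c2] act by the parities of [n1], [n2]. *)
Definition cov_klein (n1 n2 : Z) (x : CovGroup) : KleinGroup :=
  (if Z.even n1 then v2 x else if Z.even n2 then v1 x else v3 x,
   vdeg x + n1 * vc1 x + n2 * vc2 x).

Lemma sgn_mul_even n m : Z.even n = true -> sgn (n * m) = 1.
Proof. intros H. unfold sgn. now rewrite Z.even_mul, H. Qed.

Lemma sgn_mul_odd n m : Z.even n = false -> sgn (n * m) = sgn m.
Proof. intros H. unfold sgn. now rewrite Z.even_mul, H. Qed.

(** The selected component is acted on by exactly the parity of the new degree. Two even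
    coefficients would call for a component fixed by both [c1] and [c2], and [Z^3] has none. *)
Lemma cov_klein_hom n1 n2 :
  (Z.even n1 && Z.even n2)%bool = false -> is_hom (cov_klein n1 n2).
Proof.
  intros Hn x y. apply pair_eq; unfold cov_klein; cbn [gmul CovGroup];
    unfold cov_mul; ksimp; cbn [v1 v2 v3 vdeg vc1 vc2]; [|ring].
  rewrite !sgn_add.
  destruct (Z.even n1) eqn:H1, (Z.even n2) eqn:H2; try discriminate;
    repeat first [rewrite (sgn_mul_even n1) by easy | rewrite (sgn_mul_even n2) by easy
      | rewrite (sgn_mul_odd n1) by easy | rewrite (sgn_mul_odd n2) by easy]; ring.
Qed.

(** [a] goes to the diagonal of [Z^3], so whichever component [cov_klein] selects recovers it. *)
Definition klein_wit (x : KleinGroup) : WitGroup :=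
  Wit (fst x) (fst x) (fst x) (snd x) false false.

Lemma klein_wit_hom : is_hom klein_wit.
Proof.
  intros x y. unfold klein_wit. cbn. unfold wit_mul. cbn [w1 w2 w3 wdeg wc1 wc2 xorb bsgn].
  f_equal; ring.
Qed.

(** [(n1, n2)] is a row of an integral matrix of determinant 1; two even entries would make the
    determinant even. *)
Lemma orthogonal_not_both_even m1 m2 :
  exists n1 n2, n1 * m1 + n2 * m2 = 0 /\ (Z.even n1 && Z.even n2)%bool = false.
Proof.
  destruct (bezout_unimodular m1 m2) as [a [b [c [d [g [_ [E D]]]]]]].
  exists c, d. split; [easy|].
  destruct (Z.even c) eqn:Ec, (Z.even d) eqn:Ed; try easy.
  apply (f_equal Z.even) in D.
  rewrite Z.even_sub, !Z.even_mul, Ec, Ed, !Bool.orb_true_r in D. discriminate.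
Qed.

(* Lifting a solution to the cover gives an error [c1 ^ (2 m1) c2 ^ (2 m2)];
   choosing [(n1, n2)] orthogonal to [(m1, m2)] makes [cov_klein n1 n2] kill it. *)
Lemma klein_wit_verbally_closed : verbally_closed (image klein_wit).
Proof.
  intros w h [x <-] [g Hg].
  pose (y := weval (fun i => cov_lift (g i)) w).
  assert (Hy : cov_proj y = klein_wit x).
  { unfold y. rewrite (weval_hom cov_proj cov_proj_hom), <- Hg. apply weval_ext.
    intros i. apply cov_liftK. }
  destruct (orthogonal_not_both_even (vc1 y) (vc2 y)) as [n1 [n2 [E Hn]]].
  exists (fun i => klein_wit (cov_klein n1 n2 (cov_lift (g i)))). split.
  - intros i. now eexists.
  - rewrite <- (weval_hom klein_wit klein_wit_hom),
      <- (weval_hom (cov_klein n1 n2) (cov_klein_hom _ _ Hn)).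
    f_equal. fold y. unfold cov_proj, klein_wit in Hy.
    injection Hy as E1 E2 E3 Ed _ _. apply pair_eq; cbn [cov_klein fst snd].
    + now destruct (Z.even n1), (Z.even n2).
    + lia.
Qed.

Lemma klein_wit_inj x y : klein_wit x = klein_wit y -> x = y.
Proof. intros E. injection E as E1 _ _ E2. now apply pair_eq. Qed.

Lemma cyclic_generated (G : Group) (s : nat -> G) (phi : Z -> G) (u : word) :
  (forall x y, phi (x + y) = gmul (phi x) (phi y)) ->
  weval s u = phi 1 -> forall z, exists w, weval s w = phi z.
Proof.
  intros phiD Hu. induction z as [|z [w IH]|z [w IH]] using Z.peano_ind.
  - exists wone. cbn. apply (gmul_cancel_l (phi 0)). now rewrite <- phiD, gmulr1.
  - exists (wmul u w). cbn [weval]. rewrite Hu, IH, <- phiD. f_equal. lia.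
  - exists (wmul (winv u) w). cbn [weval]. apply (gmul_cancel_l (phi 1)).
    rewrite Hu, IH, gmulA, gmulrV, gmul1, <- phiD. f_equal. lia.
Qed.

Lemma wit_fin_generated : fin_generated WitGroup.
Proof.
  pose (s := fun i => match i with
    | 0 => Wit 1 0 0 0 false false | 1 => Wit 0 1 0 0 false false
    | 2 => Wit 0 0 1 0 false false | 3 => Wit 0 0 0 1 false false
    | 4 => Wit 0 0 0 0 true false | 5 => Wit 0 0 0 0 false true
    | _ => Wit 0 0 0 0 false false end%nat : WitGroup).
  exists 6%nat, s. intros [x1 x2 x3 d e1 e2].
  destruct (cyclic_generated WitGroup s (fun z => Wit z 0 0 0 false false) (wvar 0))
    with (z := x1) as [u1 H1]; [|easy|].
  { intros x y. cbn. unfold wit_mul. cbn [w1 w2 w3 wdeg wc1 wc2 bsgn xorb].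
    rewrite sgn0. f_equal; ring. }
  destruct (cyclic_generated WitGroup s (fun z => Wit 0 z 0 0 false false) (wvar 1))
    with (z := x2) as [u2 H2]; [|easy|].
  { intros x y. cbn. unfold wit_mul. cbn [w1 w2 w3 wdeg wc1 wc2 bsgn xorb].
    rewrite sgn0. f_equal; ring. }
  destruct (cyclic_generated WitGroup s (fun z => Wit 0 0 z 0 false false) (wvar 2))
    with (z := x3) as [u3 H3]; [|easy|].
  { intros x y. cbn. unfold wit_mul. cbn [w1 w2 w3 wdeg wc1 wc2 bsgn xorb].
    rewrite sgn0. f_equal; ring. }
  destruct (cyclic_generated WitGroup s (fun z => Wit 0 0 0 z false false) (wvar 3))
    with (z := d) as [u4 H4]; [|easy|].
  { intros x y. cbn. unfold wit_mul. cbn [w1 w2 w3 wdeg wc1 wc2 bsgn xorb].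
    f_equal; ring. }
  (* Translations come first and the acting generators last, so no sign enters this normal form. *)
  exists (wmul u1 (wmul u2 (wmul u3 (wmul u4
    (wmul (if e1 then wvar 4 else wone) (if e2 then wvar 5 else wone)))))).
  split.
  - intros i Hi. unfold s. do 6 (destruct i as [|i]; [lia|]). reflexivity.
  - cbn [weval]. rewrite H1, H2, H3, H4.
    destruct e1, e2; cbn [weval s gmul gone WitGroup]; unfold wit_mul;
      cbn [w1 w2 w3 wdeg wc1 wc2 bsgn xorb]; rewrite ?sgn0; f_equal; ring.
Qed.

Lemma klein_torsion_free (x : KleinGroup) : gmul x x = gone -> x = gone.
Proof.
  destruct x as [p q]. cbn. unfold kmul. cbn [fst snd]. intros E.
  injection E as E1 E2. assert (q = 0) as -> by lia. rewrite sgn0 in E1.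
  f_equal. lia.
Qed.

(* [a] is a product of involutions of the witness group, and [K] has none. *)
Lemma klein_wit_not_retract : ~ retract_of klein_wit (fun _ => True).
Proof.
  intros [r [rM rK]].
  assert (r1 : r gone = gone) by exact (rK gone).
  assert (rT : forall x, gmul x x = gone -> r x = gone).
  { intros x Hx. apply klein_torsion_free. now rewrite <- rM, Hx. }
  (* All four factors are involutions; the first pair multiplies to the translation [(1, 0, 1)], the
     second to [(0, 1, 0)]. *)
  assert (E : klein_wit ka =
    gmul (gmul (Wit 0 0 0 0 true false : WitGroup) (Wit (-1) 0 (-1) 0 true false))
         (gmul (Wit 0 0 0 0 false true : WitGroup) (Wit 0 (-1) 0 0 false true)))
    by reflexivity.
  assert (H := rK ka). rewrite E, !rM, !rT in H by easy. discriminate H.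
Qed.

Theorem mainTheorem1 :
  (exists (G : Group) (iota : KleinGroup -> G),
      fin_generated G /\ is_hom iota /\ (forall x y, iota x = iota y -> x = y) /\
      verbally_closed (image iota) /\
      ~ retract_of iota (fun _ => True))
  /\
  (forall (G : Group) (iota : KleinGroup -> G),
      fin_generated G -> is_hom iota -> (forall x y, iota x = iota y -> x = y) ->
      verbally_closed (image iota) ->
      exists L : G -> Prop,
        is_subgroup L /\ (forall k, L (iota k)) /\ index_le2 L /\
        retract_of iota L).
Proof.
  split.
  - exists WitGroup, klein_wit.
    exact (conj wit_fin_generated (conj klein_wit_hom (conj klein_wit_inj
      (conj klein_wit_verbally_closed klein_wit_not_retract)))).
  - intros G iota [n [s gen]] hom_iota inj_iota closed_iota.
    apply (retract_of_index2 hom_iota inj_iota closed_iota (n := n) (t := s)).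
    (* The support condition on [s] sits under the quantifier over elements, so it is read off at
       the identity. *)
    + destruct (gen gone) as [_ [Hs _]]. exact Hs.
    + intros x. destruct (gen x) as [w [_ Hw]]. now exists w.
Qed.
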